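(* Let $(\Gamma,a)$ be a weighted graph which is connected, transient, and satisfies the weak Harnack inequality $\mathbf{wH}(C)$ for some constant $C\ge 1$. Then for any finite subset $A\subset\Gamma$ the harmonic measure on $A$ exists; that is, for all $y\in A$ the limit $\lim_{D(x,A)\to\infty}\overline H_A(x,y)$ exists. Moreover, for $x_0\in\Gamma$, $$\lim_{D(x,A)\to\infty}\overline H_A(x,y)=\lim_{m\to+\infty}H_A^m(y),$$ where, for $m$ large enough, $$H_A^m(y)=\frac{\pi(y)\,P_y(\tau_A>\tau_{\partial B(x_0,m)})}{\mathrm{Cap}_m(A)},$$ and $\mathrm{Cap}_m(A)$ is the capacity of $A$ with respect to $B(x_0,m)$. The limit does not depend on the choice of $x_0$.
   Context: A weighted graph $(\Gamma,a)$ is a countably infinite set $\Gamma$ with a symmetric function $a:\Gamma\times\Gamma\to[0,\infty)$ such that $\pi(x):=\sum_{y\in\Gamma}a(x,y)>0$ for all $x$. Write $x\sim y$ if $a(x,y)>0$; $(\Gamma,\sim)$ is always assumed to be an infinite, locally finite graph without multiple edges. $(\Gamma,a)$ is connected if $(\Gamma,\sim)$ is. $D(x,y)$ is the graph distance in $(\Gamma,\sim)$, $D(x,A)=\inf\{D(x,y):y\in A\}$, and $B(x,R)=\{y\in\Gamma: D(x,y)<R\}$. The random walk $(X_k)_{k\ge0}$ on $(\Gamma,a)$ is the Markov chain with transition probabilities $p(x,y)=a(x,y)/\pi(x)$; $P_x$ is its law started at $x$. The Green function is $G(x,y)=\sum_{k\ge0}P_x(X_k=y)$; the (irreducible) walk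 is transient if $G(x,y)<\infty$ for some (equivalently all) $x,y$. For $A\subset\Gamma$: $\partial A=\{y\notin A:\exists x\in A,\ x\sim y\}$, $\overline A=A\cup\partial A$, $\tau_A=\inf\{k\ge1:X_k\in A\}$, $\overline\tau_A=\inf\{k\ge0:X_k\in A\}$ (with $\inf\emptyset=\infty$). A function $u:\overline A\to\mathbb R$ is harmonic in $A$ if $\sum_{y\sim x}p(x,y)(u(y)-u(x))=0$ for all $x\in A$. When $P_x(\tau_A<\infty)>0$, $\overline H_A(x,y)=P_x(X_{\tau_A}=y\mid\tau_A<+\infty)$ for $y\in A$. The capacity of $A$ with respect to $B$, for $A\subset B\subset\Gamma$, is $\mathrm{Cap}_B(A)=\sum_{x\in A}\pi(x)P_x(\overline\tau_{B^c}<\tau_A)$. $(\Gamma,a)$ satisfies $\mathbf{wH}(C)$, where $C\ge1$, if for all $x\in\Gamma$ and all $R>0$ there is $R'=R'(x,R)\ge R$ such that for any positive function $u$ harmonic on $B(x,R')$, $\max_{B(x,R)}u\le C\min_{B(x,R)}u$. *)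

(* Defs.v *)
From HB Require Import structures.
From mathcomp Require Import all_boot all_order all_algebra.
From mathcomp Require Import all_classical all_reals all_analysis.
Set Implicit Arguments.
Unset Strict Implicit.
Unset Printing Implicit Defensive.
Import Order.TTheory GRing.Theory Num.Theory.
Import numFieldNormedType.Exports.
Local Open Scope classical_set_scope.
Local Open Scope ring_scope.

Definition adj (R : realType) (V : countType) (a : V -> V -> R) : rel V :=
  fun x y => 0 < a x y.

(* The sum runs over the support of [a x], which is finite in a locally finite
   graph. *)
Definition vweight (R : realType) (V : countType) (a : V -> V -> R) (x : V) : R :=
  \sum_(y \in [set: V]) a x y.

(* Loops [0 < a x x] are not excluded. *)
Record weighted_graph (R : realType) (V : countType) (a : V -> V -> R) : Prop :=
  WeightedGraph {
    wg_infinite : infinite_set [set: V];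
    wg_sym : forall x y, a x y = a y x;
    wg_ge0 : forall x y, 0 <= a x y;
    wg_locally_finite : forall x, finite_set [set y | adj a x y];
    wg_vweight_gt0 : forall x, 0 < vweight a x }.

(* [x :: s] is a walk of length [size s] from [x] to [y]. *)
Definition walk (R : realType) (V : countType) (a : V -> V -> R) (x y : V)
    (s : seq V) : Prop :=
  path (adj a) x s /\ last x s = y.

Definition connected_graph (R : realType) (V : countType) (a : V -> V -> R) : Prop :=
  forall x y, exists s, walk a x y s.

Definition gdist (R : realType) (V : countType) (a : V -> V -> R) (x y : V) : \bar R :=
  ereal_inf [set (size s)%:R%:E | s in walk a x y].

Definition gdist_set (R : realType) (V : countType) (a : V -> V -> R) (x : V)
    (A : set V) : \bar R :=
  ereal_inf [set gdist a x y | y in A].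

Definition gball (R : realType) (V : countType) (a : V -> V -> R) (x : V) (r : R) :
    set V :=
  [set y | (gdist a x y < r%:E)%E].

(* The filter on [V] of the limits "as D(x, A) tends to infinity". *)
Definition far_from (R : realType) (V : countType) (a : V -> V -> R) (A : set V) :
    set_system V :=
  filter_from [set: R] (fun M => [set x | (M%:E < gdist_set a x A)%E]).

Global Instance far_from_filter (R : realType) (V : countType) (a : V -> V -> R)
  (A : set V) : Filter (far_from a A).
Proof.
apply: filter_from_filter; first by exists 0.
move=> M N _ _; exists (Num.max M N) => // x /= h; split.
  by apply: le_lt_trans h; rewrite lee_fin le_max lexx.
by apply: le_lt_trans h; rewrite lee_fin le_max lexx orbT.
Qed.

Definition boundary (R : realType) (V : countType) (a : V -> V -> R) (A : set V) :
    set V :=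
  [set y | ~ A y /\ exists2 x, A x & adj a x y].

Definition gclosure (R : realType) (V : countType) (a : V -> V -> R) (A : set V) :
    set V :=
  A `|` boundary a A.

Definition trans_prob (R : realType) (V : countType) (a : V -> V -> R) (x y : V) : R :=
  a x y / vweight a x.

(* A function on the closure of [A] is represented by a total function; only
   its values on [gclosure a A] are used. *)
Definition harmonic_on (R : realType) (V : countType) (a : V -> V -> R) (A : set V)
    (u : V -> R) : Prop :=
  forall x, A x ->
    \sum_(y \in [set y | adj a x y]) trans_prob a x y * (u y - u x) = 0.

(* In a locally finite graph [gball a x r] is finite and, for [0 < r], nonempty,
   so [sup] and [inf] are the maximum and the minimum. *)
Definition weak_harnack (R : realType) (V : countType) (a : V -> V -> R) (C : R) :
    Prop :=
  forall (x : V) (r : R), 0 < r -> exists2 r', r <= r' &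
    forall u : V -> R,
      (forall y, gclosure a (gball a x r') y -> 0 < u y) ->
      harmonic_on a (gball a x r') u ->
      sup (u @` gball a x r) <= C * inf (u @` gball a x r).

(* Under [P x] the process [X] is the Markov chain started at [x] with transition
   probabilities [trans_prob a]; the Markov property is written without dividing
   by the probability of the past. *)
Record random_walk (R : realType) (V : countType) (a : V -> V -> R)
    (d : measure_display) (T : measurableType d) (P : V -> probability T R)
    (X : nat -> T -> V) : Prop := RandomWalk {
  rw_measurable : forall k y, measurable [set w | X k w = y];
  rw_start : forall x, P x [set w | X 0%N w = x] = 1%E;
  rw_step : forall x n (z : nat -> V) y,
    P x ([set w | forall k, (k <= n)%N -> X k w = z k] `&`
         [set w | X n.+1 w = y]) =
    (P x [set w | forall k, (k <= n)%N -> X k w = z k] *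
     (trans_prob a (z n) y)%:E)%E }.

Definition green (R : realType) (V : countType) (d : measure_display)
    (T : measurableType d) (P : V -> probability T R) (X : nat -> T -> V)
    (x y : V) : \bar R :=
  (\sum_(0 <= k <oo) P x [set w | X k w = y])%E.

Definition transient (R : realType) (V : countType) (d : measure_display)
    (T : measurableType d) (P : V -> probability T R) (X : nat -> T -> V) : Prop :=
  exists x y, (green P X x y < +oo)%E.

(* First visit to [A] at a time [k >= k0], [+oo] if there is none. *)
Definition first_visit (R : realType) (V : countType) (T : Type)
    (X : nat -> T -> V) (k0 : nat) (A : set V) (w : T) : \bar R :=
  ereal_inf [set k%:R%:E | k in [set k : nat | (k0 <= k)%N /\ A (X k w)]].

Definition tau (R : realType) (V : countType) (T : Type) (X : nat -> T -> V)
    (A : set V) (w : T) : \bar R := first_visit R X 1 A w.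

Definition taubar (R : realType) (V : countType) (T : Type) (X : nat -> T -> V)
    (A : set V) (w : T) : \bar R := first_visit R X 0 A w.

Definition hit_prob (R : realType) (V : countType) (d : measure_display)
    (T : measurableType d) (P : V -> probability T R) (X : nat -> T -> V)
    (A : set V) (x : V) : R :=
  fine (P x [set w | (tau R X A w < +oo)%E]).

(* The law of the position at time [tau] conditioned on [tau < +oo]; meaningful
   when [0 < hit_prob P X A x]. *)
Definition hitting_law (R : realType) (V : countType) (d : measure_display)
    (T : measurableType d) (P : V -> probability T R) (X : nat -> T -> V)
    (A : set V) (x y : V) : R :=
  fine (P x [set w | exists2 k : nat, tau R X A w = k%:R%:E & X k w = y])
    / hit_prob P X A x.

Definition capacity (R : realType) (V : countType) (a : V -> V -> R)
    (d : measure_display) (T : measurableType d) (P : V -> probability T R)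
    (X : nat -> T -> V) (B A : set V) : R :=
  \sum_(x \in A)
    vweight a x * fine (P x [set w | (taubar R X (~` B) w < tau R X A w)%E]).

Definition escape_law (R : realType) (V : countType) (a : V -> V -> R)
    (d : measure_display) (T : measurableType d) (P : V -> probability T R)
    (X : nat -> T -> V) (A : set V) (x0 : V) (m : nat) (y : V) : R :=
  vweight a y *
    fine (P y [set w | (tau R X (boundary a (gball a x0 m%:R)) w
                        < tau R X A w)%E])
    / capacity a P X (gball a x0 m%:R) A.

(* Main.v *)
Require Import Defs.
From HB Require Import structures.
From mathcomp Require Import all_boot all_order all_algebra.
From mathcomp Require Import finmap.
From mathcomp Require Import all_classical all_reals all_analysis.
From mathcomp Require Import ring lra.
Import Order.TTheory GRing.Theory Num.Theory.
Import numFieldNormedType.Exports.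
Local Open Scope classical_set_scope.
Local Open Scope ring_scope.

Set Implicit Arguments.
Unset Strict Implicit.
Unset Printing Implicit Defensive.

(* Weak Harnack applied to a positive harmonic [u] minus a multiple of [u o]
   improves the Harnack constant on larger balls, which tends to 1; hence
   [G z x / G o x] tends to 1 as [x] goes to infinity.  By reversibility the
   probability of hitting [A] from [x] at [y] is [pi y / pi x] times the Green
   function [K y x] of the walk killed when it returns to [A], and decomposing
   [G y x] at the first return gives
   [K y x = G y x - \sum_(z in A) K y z * G z x].  Dividing by [G o x], the
   right-hand side tends to the escape probability [e y = P_y(tau_A = oo)], so
   the hitting law tends to [pi y * e y / \sum_z pi z * e z].  The denominator
   is positive because [\sum_z pi z * e z * G z x = pi x] for [x] in [A].  The
   escape law has the same limit, since by transience the walk leaves every ball,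
   and on [tau_A < oo] it stays in the ball of radius [m] up to time [tau_A] for
   [m] large. *)

(** * Positive linear operators and the transition operator *)

Section Operators.
Variables (R : realType) (V : countType).
Implicit Types (L : (V -> R) -> V -> R) (u v : V -> R).

(** Linearity is required for finite combinations at once, because the operators are applied to sums
    over lists of vertices; additivity and homogeneity are the cases of two terms and of one. *)
Definition lin_op L := forall (I : Type) (s : seq I) (c : I -> R) (f : I -> V -> R) x,
  L (fun z => \sum_(i <- s) c i * f i z) x = \sum_(i <- s) c i * L (f i) x.

Definition mono_op L := forall u v,
  (forall x, u x <= v x) -> forall x, L u x <= L v x.

Lemma lin_opD L u v x : lin_op L -> L (u \+ v) x = L u x + L v x.
Proof.
move=> linL; have := linL bool [:: true; false] (fun=> 1) (fun b => if b then u else v) x.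
rewrite !big_cons !big_nil !mul1r !addr0 => <-; congr (L _ x).
by apply/funext => z; rewrite !big_cons big_nil !mul1r addr0.
Qed.

Lemma lin_opZ L c u x : lin_op L -> L (fun z => c * u z) x = c * L u x.
Proof.
move=> linL; have := linL unit [:: tt] (fun=> c) (fun=> u) x.
rewrite !big_cons !big_nil !addr0 => <-; congr (L _ x).
by apply/funext => z; rewrite !big_cons big_nil addr0.
Qed.

Lemma lin_op_sum L (I : Type) (s : seq I) (f : I -> V -> R) x : lin_op L ->
  L (fun z => \sum_(i <- s) f i z) x = \sum_(i <- s) L (f i) x.
Proof.
move=> linL; have := linL I s (fun=> 1) f x.
under [RHS]eq_bigr do rewrite mul1r.
by move=> <-; congr (L _ x); apply/funext => z; under [RHS]eq_bigr do rewrite mul1r.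
Qed.

Lemma lin_op0 L x : lin_op L -> L (fun=> 0) x = 0.
Proof.
by move=> linL; have := lin_opZ 0 (fun=> 0) x linL; rewrite !mul0r.
Qed.

Lemma lin_op_comp L1 L2 : lin_op L1 -> lin_op L2 -> lin_op (L1 \o L2).
Proof.
move=> lin1 lin2 I s c f x /=; rewrite -lin1; congr (L1 _ x).
by apply/funext => z; rewrite lin2.
Qed.

Lemma mono_op_comp L1 L2 : mono_op L1 -> mono_op L2 -> mono_op (L1 \o L2).
Proof. by move=> mono1 mono2 u v uv; apply: mono1; exact: mono2. Qed.

Lemma lin_op_iter n L : lin_op L -> lin_op (iter n L).
Proof. by move=> linL; elim: n => [|n IHn] //=; exact: (lin_op_comp linL IHn). Qed.

Lemma mono_op_iter n L : mono_op L -> mono_op (iter n L).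
Proof. by move=> monoL; elim: n => [|n IHn] //=; exact: (mono_op_comp monoL IHn). Qed.

Lemma op_ge0 L u : lin_op L -> mono_op L -> (forall x, 0 <= u x) ->
  forall x, 0 <= L u x.
Proof. by move=> linL monoL u0 x; rewrite -(lin_op0 x linL); exact: monoL. Qed.

Definition kill (s : seq V) u : V -> R := fun z => if z \in s then 0 else u z.

Lemma kill_nil u : kill [::] u = u.
Proof. by apply/funext. Qed.

Lemma kill_lin s : lin_op (kill s).
Proof.
move=> I r c f x; rewrite /kill; case: ifP => // _.
by rewrite big1 // => i _; rewrite mulr0.
Qed.

Lemma kill_mono s : mono_op (kill s).
Proof. by move=> u v uv x; rewrite /kill; case: ifP. Qed.

Lemma kill_le s u : (forall x, 0 <= u x) -> forall x, kill s u x <= u x.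
Proof. by move=> u0 x; rewrite /kill; case: ifP. Qed.

Definition delta (y : V) : V -> R := fun z => (z == y)%:R.

Lemma delta_ge0 y z : 0 <= delta y z.
Proof. by rewrite ler0n. Qed.

Lemma deltaC y z : delta y z = delta z y.
Proof. by rewrite /delta eq_sym. Qed.

Lemma sum_delta (s : seq V) (c : V -> R) z : uniq s ->
  \sum_(y <- s) c y * delta y z = if z \in s then c z else 0.
Proof.
move=> us; case: ifPn => zs.
  rewrite (bigD1_seq z) //= big1 ?addr0; first by rewrite /delta eqxx mulr1.
  by move=> y yz; rewrite /delta eq_sym (negPf yz) mulr0.
rewrite big_seq big1 // => y ys.
by rewrite /delta; case: eqP zs => [->|_]; rewrite ?ys // mulr0.
Qed.

End Operators.

Arguments delta {R V}.

(** * The transition operator and the kernel killed on a finite set *)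

Section Transition.
Variables (R : realType) (V : countType) (a : V -> V -> R).
Hypothesis a_graph : weighted_graph a.
Implicit Types (s : seq V) (u v : V -> R).

Local Notation p := (trans_prob a).
Local Notation pi := (vweight a).

Definition nbrs (x : V) : seq V := enum_fset (fset_set [set y | adj a x y]).

Lemma mem_nbrs x y : (y \in nbrs x) = adj a x y.
Proof.
rewrite (in_fset_set (wg_locally_finite a_graph x)).
by apply/idP/idP => [|h]; rewrite ?inE //= ; move/set_mem.
Qed.

Lemma nbrs_uniq x : uniq (nbrs x).
Proof. exact: fset_uniq. Qed.

Lemma nbrsC x y : (y \in nbrs x) = (x \in nbrs y).
Proof. by rewrite !mem_nbrs /adj (wg_sym a_graph). Qed.

Lemma fsbig_nbrs (f : V -> R) x :
  \sum_(y \in [set y | adj a x y]) f y = \sum_(y <- nbrs x) f y.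
Proof. by rewrite fsbig_finite //; exact: (wg_locally_finite a_graph). Qed.

Lemma weight_nadj x y : y \notin nbrs x -> a x y = 0.
Proof.
rewrite mem_nbrs /adj => h; apply/eqP; move: (wg_ge0 a_graph x y).
by rewrite le0r (negPf h) orbF.
Qed.

Lemma trans_prob_nadj x y : y \notin nbrs x -> p x y = 0.
Proof. by move=> h; rewrite /trans_prob weight_nadj // mul0r. Qed.

Lemma trans_prob_ge0 x y : 0 <= p x y.
Proof. by rewrite divr_ge0 ?(wg_ge0 a_graph) // ltW // (wg_vweight_gt0 a_graph). Qed.

Lemma trans_prob_gt0 x y : adj a x y -> 0 < p x y.
Proof. by move=> h; rewrite divr_gt0 // (wg_vweight_gt0 a_graph). Qed.

Lemma vweight_nbrs x : pi x = \sum_(y <- nbrs x) a x y.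
Proof.
rewrite -fsbig_nbrs /vweight; apply/esym/fsbig_widen => // y [_ /= h].
by apply: weight_nadj; rewrite mem_nbrs; apply/negP.
Qed.

Lemma vweight_neq0 x : pi x != 0.
Proof. by rewrite gt_eqF // (wg_vweight_gt0 a_graph). Qed.

Lemma reversible x y : pi x * p x y = pi y * p y x.
Proof.
rewrite /trans_prob !(mulrC (pi _)) !divfK ?vweight_neq0 //.
exact: (wg_sym a_graph).
Qed.

Definition trans_op u : V -> R := fun x => \sum_(y <- nbrs x) p x y * u y.

Lemma trans_op_lin : lin_op trans_op.
Proof.
move=> I s c f x; rewrite /trans_op.
under eq_bigr do rewrite mulr_sumr.
rewrite exchange_big /=; apply: eq_bigr => i _; rewrite mulr_sumr.
by apply: eq_bigr => y _; rewrite mulrCA.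
Qed.

Lemma trans_op_mono : mono_op trans_op.
Proof.
by move=> u v uv x; apply: ler_sum => y _; rewrite ler_wpM2l // trans_prob_ge0.
Qed.

Lemma trans_op_sum1 x : \sum_(y <- nbrs x) p x y = 1.
Proof. by rewrite -mulr_suml -vweight_nbrs divff // vweight_neq0. Qed.

Lemma trans_op_cvg (u_ : nat -> V -> R) u x :
  (forall z, u_ n z @[n --> \oo] --> u z) -> trans_op (u_ n) x @[n --> \oo] --> trans_op u x.
Proof.
move=> cu; rewrite /trans_op; apply: cvg_big => [|y _]; first exact: add_continuous.
by apply: cvgM; [exact: cvg_cst|exact: cu].
Qed.

Lemma trans_op_delta y x : trans_op (delta y) x = p x y.
Proof.
rewrite /trans_op; under eq_bigr do rewrite /delta eq_sym.
rewrite sum_delta ?nbrs_uniq //; case: ifPn => // h.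
by rewrite trans_prob_nadj.
Qed.

Lemma harmonic_onP (B : set V) u :
  harmonic_on a B u <-> forall x, B x -> trans_op u x = u x.
Proof.
have E x : \sum_(y \in [set y | adj a x y]) p x y * (u y - u x) = trans_op u x - u x.
  rewrite fsbig_nbrs /trans_op; under eq_bigr do rewrite mulrBr.
  by rewrite sumrB -mulr_suml trans_op_sum1 mul1r.
split=> h x Bx; first by apply/eqP; rewrite -subr_eq0 -E h.
by rewrite E h ?subrr.
Qed.

(** Killing acts before the transition, hence on the positions from time 1 on: the starting point
    may lie in [s], as for [tau]. *)
Definition killed_op s u : V -> R := trans_op (kill s u).

Lemma killed_op_lin s : lin_op (killed_op s).
Proof. exact: (lin_op_comp trans_op_lin (@kill_lin _ _ s)). Qed.

Lemma killed_op_mono s : mono_op (killed_op s).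
Proof. exact: (mono_op_comp trans_op_mono (@kill_mono _ _ s)). Qed.

Lemma killed_op_nil : killed_op [::] = trans_op.
Proof. by apply/funext => u; rewrite /killed_op kill_nil. Qed.

(* [kill_kernel s n x y] is the probability, from [x], of being at [y] at time
   [n.+1] without visiting [s] at the times [1, ..., n]. *)
Definition kill_kernel s n (x y : V) : R := iter n (killed_op s) (trans_op (delta y)) x.

Lemma iter_killed_op_lin s n : lin_op (iter n (killed_op s)).
Proof. exact: lin_op_iter (killed_op_lin s). Qed.

Lemma iter_trans_op_lin n : lin_op (iter n trans_op).
Proof. exact: lin_op_iter trans_op_lin. Qed.

Lemma iter_trans_op_mono n : mono_op (iter n trans_op).
Proof. exact: mono_op_iter trans_op_mono. Qed.

Lemma trans_op_ge0 u : (forall x, 0 <= u x) -> forall x, 0 <= trans_op u x.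
Proof. exact: op_ge0 trans_op_lin trans_op_mono. Qed.

Lemma iter_trans_op_ge0 n u : (forall x, 0 <= u x) -> forall x, 0 <= iter n trans_op u x.
Proof. exact: op_ge0 (iter_trans_op_lin n) (@iter_trans_op_mono n). Qed.

Lemma iter_killed_op_ge0 s n u : (forall x, 0 <= u x) -> forall x, 0 <= iter n (killed_op s) u x.
Proof. exact: op_ge0 (iter_killed_op_lin s n) (mono_op_iter n (@killed_op_mono s)). Qed.

Lemma iter_killed_op_le s n u : (forall x, 0 <= u x) ->
  forall x, iter n (killed_op s) u x <= iter n trans_op u x.
Proof.
move=> u0; elim: n => [//|n IHn] x /=.
rewrite /killed_op; apply: trans_op_mono => z; apply: le_trans (IHn z).
by apply: kill_le; exact: iter_killed_op_ge0.
Qed.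

Lemma kill_kernel_ge0 s n x y : 0 <= kill_kernel s n x y.
Proof. by apply: iter_killed_op_ge0; apply: trans_op_ge0 => z; exact: delta_ge0. Qed.

Lemma kill_kernel_le s n x y : kill_kernel s n x y <= iter n.+1 trans_op (delta y) x.
Proof.
by rewrite iterSr; apply: iter_killed_op_le; apply: trans_op_ge0 => z; exact: delta_ge0.
Qed.

(** The definition of the kernel peels off the first step of the path; this recursion peels off the
    last one. *)
Lemma kill_kernelS s n x y : kill_kernel s n.+1 x y =
  \sum_(w <- nbrs y) (if w \in s then 0 else p w y) * kill_kernel s n x w.
Proof.
rewrite /kill_kernel iterSr /killed_op.
rewrite -(lin_op_comp (iter_killed_op_lin s n) trans_op_lin) /=.
congr (iter n _ (trans_op _) x); apply/funext => z; rewrite sum_delta ?nbrs_uniq //.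
rewrite /kill trans_op_delta; case: ifPn => zs; first by case: ifP.
by case: ifPn => // zy; rewrite trans_prob_nadj // nbrsC.
Qed.

(** Reversing a path keeps the set of its intermediate points, so detailed balance survives the
    killing. The induction matches the last step on one side with the first step on the other. *)
Lemma kill_kernel_sym s n x y : pi x * kill_kernel s n x y = pi y * kill_kernel s n y x.
Proof.
elim: n x y => [|n IHn] x y; first by rewrite /kill_kernel /= !trans_op_delta reversible.
rewrite kill_kernelS mulr_sumr [X in _ = _ * X]/kill_kernel /= /killed_op /trans_op mulr_sumr.
apply: eq_bigr => w _; rewrite /kill; case: ifP => _; first by rewrite mul0r !mulr0.
by rewrite mulrCA IHn [LHS]mulrA (mulrC (p w y)) reversible -mulrA.
Qed.

(** A finite-time form of optional stopping for the Poisson equation [u = v + trans_op u]. It is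
    applied to a Green function, with [v] a [delta]. *)
Lemma stopped_poisson s u v n y : uniq s -> (forall x, u x = v x + trans_op u x) ->
  trans_op u y = \sum_(j < n) (\sum_(z <- s) u z * kill_kernel s j y z
                          + iter j (killed_op s) (trans_op (kill s v)) y)
            + iter n (killed_op s) (trans_op u) y.
Proof.
move=> us uE; elim: n => [|n IHn]; first by rewrite big_ord0 add0r.
rewrite IHn big_ord_recr iterSr -addrA; congr (_ + _).
(* On [s] the value of [u] is kept as a sum of deltas (the path stops there); off [s] the equation
   replaces [u] by the source [v] plus one further step. *)
have {1}-> : trans_op u = trans_op (fun w => \sum_(z <- s) u z * delta z w) \+ trans_op (kill s v)
                  \+ killed_op s (trans_op u).
  apply/funext => x /=; rewrite /killed_op.
  rewrite -!(lin_opD _ _ _ trans_op_lin).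
  congr (trans_op _ x); apply/funext => z /=.
  rewrite sum_delta // /kill; case: ifP => _; first by rewrite !addr0.
  by rewrite add0r.
rewrite !(lin_opD _ _ _ (iter_killed_op_lin s n)).
congr (_ + _ + _).
exact: (lin_op_comp (iter_killed_op_lin s n) trans_op_lin).
Qed.

(** A nonnegative [u] dominates [u z * delta z]. When [u] is itself an iterate, this keeps a single
    term of the Chapman-Kolmogorov sum. *)
Lemma iter_trans_op_lb n u z x : (forall w, 0 <= u w) ->
  u z * iter n trans_op (delta z) x <= iter n trans_op u x.
Proof.
move=> u0; rewrite -(lin_opZ _ _ _ (iter_trans_op_lin n)); apply: iter_trans_op_mono => w.
by rewrite /delta; case: eqP => [->|_]; rewrite ?mulr1 ?mulr0.
Qed.

Lemma walk_iter_trans_op x y t : walk a x y t -> 0 < iter (size t) trans_op (delta y) x.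
Proof.
elim: t x => [|z t IHt] x; first by case=> _ /= ->; rewrite /delta eqxx.
case=> /= /andP[xz zt] tE; have zy : walk a z y t by [].
apply: lt_le_trans (@iter_trans_op_lb 1 (iter (size t) trans_op (delta y)) z x _) => /=.
  by rewrite mulr_gt0 ?IHt // trans_op_delta trans_prob_gt0.
by apply: iter_trans_op_ge0 => // v; exact: delta_ge0.
Qed.

End Transition.

(** * Green functions *)

Lemma cvg_series_shift (R : realType) (f : nat -> R) (m : nat) (l : R) :
  series f @ \oo --> l -> series (fun n => f (n + m)%N) @ \oo --> l - series f m.
Proof.
have -> : series (fun n => f (n + m)%N) = (fun n => series f (n + m)%N - series f m).
  apply/funext => n; rewrite series_addn addrC addKr.
  by rewrite seriesEnat /= -[X in _ = \sum_(X <= _ < _) _]add0n big_addn addnK.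
by move=> cf; apply: cvgB; [rewrite (cvg_shiftn m)|exact: cvg_cst].
Qed.

Lemma series_mono (R : realType) (f : nat -> R) : (forall n, 0 <= f n) ->
  {homo series f : n m / (n <= m)%N >-> n <= m}.
Proof.
by move=> f0; apply/nondecreasing_seqP => n; rewrite !seriesEnat /= big_nat_recr //= lerDl.
Qed.

Section Green.
Variables (R : realType) (V : countType) (a : V -> V -> R).
Hypothesis a_graph : weighted_graph a.
Local Notation pi := (vweight a).

Lemma iter_trans_op_delta_ge0 n x z : 0 <= iter n (trans_op a) (delta x) z.
Proof. by apply: iter_trans_op_ge0 => // v; exact: delta_ge0. Qed.

Lemma connected_walk x y : connected_graph a ->
  exists n, 0 < iter n (trans_op a) (delta y) x.
Proof. by move=> /(_ x y) [t xy]; exists (size t); exact: walk_iter_trans_op. Qed.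

(** Prolonging paths from [x] to [y] by a fixed passage from [x0] to [x] and one from [y] to [y0]
    bounds the terms of this series by a constant times shifted terms of the given one. *)
Lemma series_iter_trans_op_cvg x0 y0 x y : connected_graph a ->
  cvgn (series (fun n => iter n (trans_op a) (delta y0) x0)) ->
  cvgn (series (fun n => iter n (trans_op a) (delta y) x)).
Proof.
move=> a_conn cv; have [i pi0] := connected_walk x0 x a_conn.
have [j pj0] := connected_walk y y0 a_conn.
set c := iter i (trans_op a) (delta x) x0 in pi0.
set d := iter j (trans_op a) (delta y0) y in pj0.
have bnd n : c * d * iter n (trans_op a) (delta y) x
    <= iter (n + (i + j)) (trans_op a) (delta y0) x0.
  rewrite addnCA iterD; apply: le_trans (iter_trans_op_lb a_graph i x _ _); last first.
    by move=> w; exact: iter_trans_op_delta_ge0.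
  rewrite -mulrA mulrC ler_wpM2r ?(ltW pi0) // iterD.
  by apply: (iter_trans_op_lb a_graph (u := iter j (trans_op a) (delta y0)) n y) => w;
    exact: iter_trans_op_delta_ge0.
pose f n := iter n (trans_op a) (delta y0) x0.
apply: (@series_le_cvg _ _ (fun n => (c * d)^-1 * f (n + (i + j))%N)).
- by move=> n; exact: iter_trans_op_delta_ge0.
- move=> n; rewrite mulr_ge0 ?iter_trans_op_delta_ge0 // invr_ge0 mulr_ge0 //; exact: ltW.
- by move=> n; rewrite ler_pdivlMl ?mulr_gt0.
apply: (@is_cvg_seriesZ _ (fun n => f (n + (i + j))%N)).
apply/cvg_ex; eexists; apply: cvg_series_shift; exact: cv.
Qed.

(** This is G(z, x): the starting point comes second, so that [green_fun x] is a function on which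
    the operators act. *)
Definition green_fun (x z : V) : R := limn (series (fun n => iter n (trans_op a) (delta x) z)).
(** Here the walk starts at [y], and term [n] concerns time [n.+1], so time 0 is not counted. For
    [z] in [s] this is the probability that the first visit to [s] after time 0 occurs at [z]. *)
Definition killed_green s (y z : V) : R := limn (series (fun n => kill_kernel a s n y z)).

Hypothesis a_summable : forall x z, cvgn (series (fun n => iter n (trans_op a) (delta x) z)).

(** The Green series without its first term is [trans_op] of the series; the limit passes through
    [trans_op] because each vertex has finitely many neighbours. *)
Lemma green_funE x z : green_fun x z = delta x z + trans_op a (green_fun x) z.
Proof.
have h1 := cvg_series_shift (m := 1) (@a_summable x z).
have h2 : series (fun n => iter (n + 1) (trans_op a) (delta x) z) @ \oo
    --> trans_op a (green_fun x) z.
  have := @trans_op_cvg _ _ a (fun n w => series (fun n => iter n (trans_op a) (delta x) w) n)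
    (green_fun x) z (@a_summable x); apply: cvg_trans; apply: near_eq_cvg.
  near=> n; rewrite !seriesEnat /=.
  under eq_bigr do rewrite addn1 /=.
  rewrite -lin_op_sum; last exact: trans_op_lin.
  by congr (trans_op a _ z); apply/funext => w; rewrite seriesEnat.
have E : green_fun x z - series (fun n => iter n (trans_op a) (delta x) z) 1
    = trans_op a (green_fun x) z.
  exact: (cvg_unique _ h1 h2).
by rewrite -E seriesEnat /= big_nat1 /= addrC subrK.
Unshelve. all: by end_near. Qed.

Lemma green_fun_ge n x z : series (fun n => iter n (trans_op a) (delta x) z) n <= green_fun x z.
Proof.
apply: nondecreasing_cvgn_le (@a_summable x z) n.
by apply: series_mono => n; exact: iter_trans_op_delta_ge0.
Qed.

Lemma green_fun_ge0 x z : 0 <= green_fun x z.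
Proof. by have := green_fun_ge 0 x z; rewrite seriesEnat /= big_geq. Qed.

Lemma green_fun_gt0 x z : connected_graph a -> 0 < green_fun x z.
Proof.
move=> a_conn; have [n gt0] := connected_walk z x a_conn.
apply: lt_le_trans (green_fun_ge n.+1 x z); rewrite seriesEnat /= big_nat_recr //=.
rewrite ltr_wpDl // sumr_ge0 // => i _; exact: iter_trans_op_delta_ge0.
Qed.

(** The [n]-th iterate of the Green function is the tail of its series from index [n]. *)
Lemma iter_trans_op_green_fun_cvg0 x z : iter n (trans_op a) (green_fun x) z @[n --> \oo] --> 0.
Proof.
have E n w : iter n (trans_op a) (green_fun x) w
    = green_fun x w - series (fun n => iter n (trans_op a) (delta x) w) n.
  elim: n w => [|n IHn] w; first by rewrite seriesEnat /= big_geq // subr0.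
  have uE : green_fun x = delta x \+ trans_op a (green_fun x).
    by apply/funext => v; rewrite {1}green_funE.
  have := IHn w; rewrite {1}uE (lin_opD _ _ _ (iter_trans_op_lin a n)) -iterSr.
  rewrite !seriesEnat /= big_nat_recr //= => h; rewrite opprD addrA -h.
  by rewrite addrAC subrr add0r.
have -> : (fun n => iter n (trans_op a) (green_fun x) z) = (fun n => green_fun x z
    - series (fun n => iter n (trans_op a) (delta x) z) n) by apply/funext => n.
rewrite -[X in _ --> X](subrr (green_fun x z)).
by apply: cvgB; [exact: cvg_cst|exact: a_summable].
Qed.

Lemma killed_green_cvg s y z : cvgn (series (fun n => kill_kernel a s n y z)).
Proof.
apply: (@series_le_cvg _ _ (fun n => iter (n + 1) (trans_op a) (delta z) y)).
- by move=> n; exact: kill_kernel_ge0.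
- by move=> n; exact: iter_trans_op_delta_ge0.
- by move=> n; rewrite addn1; exact: kill_kernel_le.
apply/cvg_ex; eexists; apply: (cvg_series_shift (m := 1) (@a_summable z y)).
Qed.

Lemma killed_green_sym s x y : pi x * killed_green s x y = pi y * killed_green s y x.
Proof.
rewrite /killed_green -![pi _ * _]lim_seriesZ; try exact: killed_green_cvg.
congr (limn (series _)); apply/funext => n; exact: kill_kernel_sym.
Qed.

(** The limit of [stopped_poisson] as [n] grows: visits to [x] at times at least 1 are sorted by the
    first visit to [s]. If [x] lies in [s], no visit precedes that time, hence the case
    distinction. *)
Lemma killed_green_decomp s x y : uniq s ->
  trans_op a (green_fun x) y = \sum_(z <- s) green_fun x z * killed_green s y z
    + (if x \in s then 0 else killed_green s y x).
Proof.
move=> us; have H n := stopped_poisson n y us (green_funE x).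
set c : R := if x \in s then 0 else 1.
have kE j : iter j (killed_op a s) (trans_op a (kill s (delta x))) y = c * kill_kernel a s j y x.
  have lin_j := lin_op_comp (iter_killed_op_lin a s j) (trans_op_lin a).
  rewrite /kill_kernel -(lin_opZ _ _ _ lin_j) /=.
  congr (iter j _ (trans_op a _) y); apply/funext => w; rewrite /kill /c /delta.
  by case: (eqVneq w x) => [->|_]; [case: ifP|case: ifP]; rewrite ?mulr0 ?mul0r ?mulr1.
pose r n := iter n (killed_op a s) (trans_op a (green_fun x)) y.
(* The killed remainder is at most the unkilled iterate of the Green function, which tends to 0. *)
have r0 : r n @[n --> \oo] --> 0.
  have h := iter_trans_op_green_fun_cvg0 x y; rewrite -cvg_shiftS in h.
  apply: (squeeze_cvgr _ (cvg_cst 0) h); near=> n.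
  rewrite /r; apply/andP; split.
    by apply: iter_killed_op_ge0 => //; apply: trans_op_ge0 => // w; exact: green_fun_ge0.
  rewrite /= -iterS iterSr.
  by apply: iter_killed_op_le => //; apply: trans_op_ge0 => // w; exact: green_fun_ge0.
suff h : (fun=> trans_op a (green_fun x) y) @ \oo -->
    \sum_(z <- s) green_fun x z * killed_green s y z
    + (if x \in s then 0 else killed_green s y x).
  exact: (cvg_unique _ (cvg_cst _) h).
have -> : (fun=> trans_op a (green_fun x) y) = (fun n =>
    \sum_(z <- s) green_fun x z * series (fun n => kill_kernel a s n y z) n
    + c * series (fun n => kill_kernel a s n y x) n + r n).
  apply/funext => n; rewrite (H n) big_split /=; congr (_ + _ + _).
    rewrite exchange_big /=; apply: eq_bigr => z _.
    by rewrite seriesEord /= mulr_sumr.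
  by rewrite seriesEord /= mulr_sumr; apply: eq_bigr => j _; rewrite kE.
rewrite -[X in _ --> X]addr0; apply: cvgD => //; apply: cvgD.
  apply: cvg_big => [|z _]; first exact: add_continuous.
  by apply: cvgM; [exact: cvg_cst|exact: killed_green_cvg].
have -> : (if x \in s then 0 else killed_green s y x) = c * killed_green s y x.
  by rewrite /c; case: ifP; rewrite ?mul0r ?mul1r.
by apply: cvgM; [exact: cvg_cst|exact: killed_green_cvg].
Unshelve. all: by end_near. Qed.

(** By reversibility, dividing by [pi x] gives the last-exit decomposition: the walk from [x] in [s]
    has almost surely a last visit to [s], so these probabilities sum to 1. The proof is algebraic:
    [killed_green_decomp] yields a double sum that symmetry cancels. *)
Lemma last_exit s x : uniq s -> x \in s ->
  pi x = \sum_(z <- s) pi z * (1 - \sum_(y <- s) killed_green s z y) * green_fun x z.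
Proof.
move=> us xs.
under eq_bigr => z _ do 
  rewrite mulrBr mulr1 mulrBl [pi z * \sum_(_ <- _) _]mulr_sumr [X in _ - X]mulr_suml.
rewrite sumrB.
have -> : \sum_(z <- s) pi z * green_fun x z = pi x +
    \sum_(z <- s) \sum_(y <- s) pi z * killed_green s z y * green_fun x y.
  under eq_bigr => z _ do
    rewrite green_funE deltaC (killed_green_decomp _ _ us) xs addr0 mulrDr [X in _ + X]mulr_sumr.
  rewrite big_split /= sum_delta // xs; congr (_ + _).
  by apply: eq_bigr => z _; apply: eq_bigr => y _; rewrite mulrCA mulrC.
rewrite -addrA; apply/esym/eqP; rewrite -subr_eq0 [X in X == _]addrC addKr subr_eq0; apply/eqP.
rewrite exchange_big /=; apply: eq_bigr => z _; apply: eq_bigr => y _.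
by rewrite killed_green_sym.
Qed.
End Green.

(** * Balls and the Harnack inequality *)

Section Balls.
Variables (R : realType) (V : countType) (a : V -> V -> R).
Implicit Types (x y : V) (r : R).

Lemma gballP x r y : gball a x r y <-> exists2 t, walk a x y t & (size t)%:R < r.
Proof.
split=> [|[t xy tr]]; last first.
  apply: le_lt_trans (_ : ((size t)%:R%:E < r%:E)%E); last by rewrite lte_fin.
  by apply: ereal_inf_lbound; exists t.
by move=> /ereal_inf_lt [_ [t xy <-]]; rewrite lte_fin; exists t.
Qed.

Lemma gball_le x r r' : r <= r' -> gball a x r `<=` gball a x r'.
Proof.
by move=> rr' y /gballP[t xy tr]; apply/gballP; exists t => //; exact: lt_le_trans rr'.
Qed.

Lemma gball_center x r : 0 < r -> gball a x r x.
Proof. by move=> r0; apply/gballP; exists [::]. Qed.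

Lemma gclosure_gball x r : gclosure a (gball a x r) `<=` gball a x (r + 1).
Proof.
move=> y [|[_ [z /gballP[t [xz tz] tr] zy]]]; first by apply: gball_le; rewrite lerDl.
apply/gballP; exists (rcons t y).
  by split; rewrite ?last_rcons // rcons_path xz tz.
by rewrite size_rcons -natr1 ltrD2r.
Qed.

Lemma gball_near x y : connected_graph a -> \forall m \near \oo, gball a x m%:R y.
Proof.
move=> /(_ x y) [t xy]; near=> m; apply/gballP; exists t => //.
by rewrite ltr_nat; near: m; exact: nbhs_infty_gt.
Unshelve. all: by end_near. Qed.

Lemma finite_walk_ends x n : weighted_graph a ->
  finite_set [set y | exists2 t, walk a x y t & size t = n].
Proof.
move=> a_graph; elim: n => [|n IHn].
  apply: (sub_finite_set _ (finite_set1 x)) => y [[|//] [_ <-] _]; by [].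
apply: sub_finite_set (bigcup_finite IHn (fun z _ => wg_locally_finite a_graph z)) => y [t].
case/lastP: t => // t z [+ +]; rewrite last_rcons rcons_path => /andP[xt tz] <-.
by rewrite size_rcons => -[tn]; exists (last x t) => //; exists t.
Qed.

Lemma finite_gball x r : weighted_graph a -> finite_set (gball a x r).
Proof.
move=> a_graph; set N := (Num.truncn r).+1.
apply: sub_finite_set (bigcup_finite (finite_II N) (fun n _ => finite_walk_ends x n a_graph)).
move=> y /gballP[t xy tr]; exists (size t); last by exists t.
by rewrite /= -(ltr_nat R) (lt_trans tr) // truncnS_gt.
Qed.

(** A walk from a point of [B] to [y] bounds the distance from that point to [A], and [B] has
    finitely many points. *)
Lemma far_from_notin (A B : set V) y : connected_graph a -> A y -> finite_set B ->
  \forall x \near far_from a A, ~ B x.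
Proof.
move=> a_conn Ay /finite_fsetP[X ->].
have H (z : V) : z \in X -> far_from a A (fun x => x <> z).
  move=> _; have [t zy] := a_conn z y; exists (size t)%:R => //= x + xz.
  rewrite {}xz; apply/negP; rewrite -leNgt.
  apply: le_trans (_ : (gdist a z y <= _)%E); first by apply: ereal_inf_lbound; exists y.
  by apply: ereal_inf_lbound; exists t.
have := filter_bigI (far_from_filter a A) H; apply: filterS => x h /= xX; exact: (h x).
Qed.

End Balls.

(** * Improvement of the Harnack constant and ratios of Green functions *)

Section Harnack.
Variables (R : realType) (V : countType) (a : V -> V -> R).
Hypothesis a_graph : weighted_graph a.

(** Two changes prepare the iteration: [u] is only nonnegative, since the subtraction of a constant
    may create zeros, and values are compared only with the one at the centre. *)
Definition harnack_at (o : V) (c : R) := forall r : R, 0 < r -> exists2 r', r <= r' &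
  forall u : V -> R, (forall y, gclosure a (gball a o r') y -> 0 <= u y) ->
    harmonic_on a (gball a o r') u ->
    forall p, gball a o r p -> u p <= c * u o /\ u o <= c * u p.

Lemma harmonic_onD (B : set V) (u : V -> R) (c : R) : harmonic_on a B u ->
  harmonic_on a B (fun x => u x + c).
Proof.
move=> hu x Bx; rewrite -[RHS](hu x Bx); apply: eq_fsbigr => z _.
by rewrite opprD addrACA subrr addr0.
Qed.

Lemma finite_image_bounded (B : set V) (u : V -> R) : finite_set B ->
  has_ubound (u @` B) /\ has_lbound (u @` B).
Proof.
move=> /finite_fsetP[X ->].
have H (z : V) : z \in X -> `|u z| <= \sum_(x <- enum_fset X) `|u x|.
  by move=> zX; rewrite (big_rem z) //= lerDl sumr_ge0.
split; [exists (\sum_(x <- enum_fset X) `|u x|)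
  |exists (- \sum_(x <- enum_fset X) `|u x|)] => _ [z zX <-].
  exact: le_trans (ler_norm _) (H z zX).
by rewrite lerNl (le_trans _ (H z zX)) // -normrN ler_norm.
Qed.

Lemma weak_harnack_at o C : 1 <= C -> weak_harnack a C -> harnack_at o C.
Proof.
move=> C1 wH r r0; have [r' rr' H] := wH o r r0; exists r' => // u u0 hu.
suff K p q : gball a o r p -> gball a o r q -> u p <= C * u q.
  by move=> p Bp; split; apply: K => //; exact: gball_center.
move=> Bp Bq; apply/ler_addgt0Pr => e e0.
have C0 : 0 < C by exact: lt_le_trans C1.
(* Adding [e / C] makes [u] positive and keeps it harmonic; multiplied by [C], the error is [e]. *)
have d0 : 0 < e / C by rewrite divr_gt0.
  have v0 x : gclosure a (gball a o r') x -> 0 < u x + e / C.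
    by move=> /u0 ux; rewrite ltr_wpDl.
  have := H _ v0 (harmonic_onD (e / C) hu).
  set E := (X in sup X) => supE.
  have Ep : u p + e / C <= sup E.
    apply: ub_le_sup; last by exists p.
    exact: (finite_image_bounded (fun x => u x + e / C) (finite_gball o r a_graph)).1.
  have Eq : inf E <= u q + e / C.
    apply: ge_inf; last by exists q.
    exact: (finite_image_bounded (fun x => u x + e / C) (finite_gball o r a_graph)).2.
  have := le_trans Ep (le_trans supE (ler_wpM2l (ltW C0) Eq)).
  rewrite mulrDr [C * (e / C)]mulrC divfK ?gt_eqF // => h.
  by apply: le_trans h; rewrite lerDl ltW.
Qed.

(* Apply the inequality with constant [c] to [u - u o / c], which is nonnegative
   on a ball where that same inequality holds for [u]. *)
Lemma harnack_at_improve o c : 1 <= c -> harnack_at o c -> harnack_at o (c - 1 + c^-1).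
Proof.
move=> c1 H r r0; have [r1 rr1 H1] := H r r0.
(* Radius [r1 + 1] covers the closure of the ball of radius [r1], on which [u - u o / c] has to be
   nonnegative. *)
have r10 : 0 < r1 + 1 by rewrite ltr_wpDr // (lt_le_trans r0).
have [r2 r12 H2] := H _ r10.
have c0 : 0 < c by exact: lt_le_trans c1.
have le12 : r1 <= r2 by rewrite (le_trans _ r12) // lerDl.
exists r2; first exact: le_trans le12.
move=> u u0 hu p Bp.
have oB2 : gball a o r2 o by apply: gball_center; exact: lt_le_trans r12.
have uo0 : 0 <= u o by apply: u0; left.
have v0 y : gclosure a (gball a o r1) y -> 0 <= u y + - (c^-1 * u o).
  move=> /gclosure_gball By; rewrite subr_ge0 ler_pdivrMl //.
  by have [] := H2 u u0 hu y By.
have hv : harmonic_on a (gball a o r1) (fun y => u y + - (c^-1 * u o)).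
  by apply: harmonic_onD => x Bx; apply: hu; exact: gball_le Bx.
have [h1 h2] := H1 _ v0 hv p Bp.
have cV : c * (c^-1 * u o) = u o by rewrite mulrA divff ?mul1r // gt_eqF.
have up0 : 0 <= u p by apply: u0; left; apply: gball_le Bp; exact: le_trans le12.
split.
  by move: h1; rewrite mulrBr cV => h1; lra.
(* The second inequality yields only [u o <= c^2 / (2c - 1) * u p]. This factor is at most
   [c - 1 + c^-1]: once denominators are cleared, the difference is [(c - 1)^3]. *)
rewrite -(ler_pM2l c0).
have -> : c * ((c - 1 + c^-1) * u p) = (c * c - c + 1) * u p.
  by field; rewrite gt_eqF.
have k : (2 * c - 1) * u o <= c * c * u p.
  move: h2; rewrite mulrBr cV => h2.
  have := ler_wpM2l (ltW c0) h2; rewrite mulrDr mulrN cV; nra.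
have c21 : 0 < 2 * c - 1 by lra.
rewrite -(ler_pM2l c21).
have -> : (2 * c - 1) * (c * u o) = c * ((2 * c - 1) * u o) by ring.
apply: le_trans (ler_wpM2l (ltW c0) k) _.
have -> : (2 * c - 1) * ((c * c - c + 1) * u p)
  = c * (c * c * u p) + (c - 1) ^+ 3 * u p by ring.
by rewrite lerDl mulr_ge0 // exprn_ge0 // subr_ge0.
Qed.

Lemma harnack_at_le o c c' : c <= c' -> harnack_at o c -> harnack_at o c'.
Proof.
move=> cc' H r r0; have [r' rr' H'] := H r r0; exists r' => // u u0 hu p Bp.
have o0 : 0 <= u o.
  by apply: u0; left; apply: gball_center; exact: lt_le_trans rr'.
have p0 : 0 <= u p by apply: u0; left; exact: gball_le Bp.
have [h1 h2] := H' u u0 hu p Bp.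
by split; [apply: le_trans h1 _|apply: le_trans h2 _]; rewrite ler_wpM2r.
Qed.

(** Since [c - 1 + c^-1 = 1 + (c - 1) * (1 - c^-1)], one improvement multiplies the excess [c - 1]
    by [1 - c^-1], which is at most [1 - C^-1] as long as [c <= C]. *)
Lemma harnack_at_iter o C n : 1 <= C -> harnack_at o C ->
  harnack_at o (1 + (C - 1) * (1 - C^-1) ^+ n).
Proof.
move=> C1 HC; have C0 : 0 < C by exact: lt_le_trans C1.
have t0 : 0 <= 1 - C^-1 by rewrite subr_ge0 invf_le1.
elim: n => [|n IHn]; first by rewrite expr0 mulr1 addrC subrK.
set c := 1 + _ in IHn.
have c1 : 1 <= c by rewrite lerDl mulr_ge0 ?exprn_ge0 // subr_ge0.
have c0 : 0 < c by exact: lt_le_trans c1.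
have cC : c <= C.
  rewrite -lerBrDl ler_piMr ?subr_ge0 // exprn_ile1 // gerBl invr_ge0; exact: ltW.
apply: harnack_at_le (harnack_at_improve c1 IHn).
have -> : c - 1 + c^-1 = 1 + (c - 1) * (1 - c^-1) by field; rewrite gt_eqF.
rewrite lerD2l exprSr mulrA.
have -> : (C - 1) * (1 - C^-1) ^+ n = c - 1 by rewrite /c addrAC subrr add0r.
by rewrite ler_wpM2l ?subr_ge0 // lerD2l lerN2 lef_pV2.
Qed.

(** The function [green_fun a x] is harmonic off [x], so once [x] is outside the ball of radius [r']
    about [o], Harnack applies with a constant [1 + d] as close to 1 as desired. *)
Lemma green_ratio_cvg A C y o z : connected_graph a -> A y ->
  1 <= C -> weak_harnack a C ->
  (forall x z, cvgn (series (fun n => iter n (trans_op a) (delta x) z))) ->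
  green_fun a x z / green_fun a x o @[x --> far_from a A] --> (1 : R).
Proof.
move=> a_conn Ay C1 wH a_sum; have C0 : 0 < C by exact: lt_le_trans C1.
apply/cvgrPdist_le => e e0.
have t1 : `|1 - C^-1| < 1.
  by rewrite ger0_norm ?subr_ge0 ?invf_le1 // gtrBl invr_gt0.
have /cvgrPdist_le/(_ e e0)[n _ /(_ n (leqnn n))] := cvg_geometric (C - 1) t1.
rewrite /= sub0r normrN; set d := (C - 1) * _ => de.
have [t oz] := a_conn o z.
have r0 : (0 : R) < (size t).+1%:R by rewrite ltr0n.
have [r' _ H] := harnack_at_iter n C1 (weak_harnack_at o C1 wH) r0.
have := far_from_notin a_conn Ay (finite_gball o r' a_graph).
apply: filterS => x xB /=.
have hx : harmonic_on a (gball a o r') (green_fun a x).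
  apply/(harmonic_onP a_graph) => w Bw; rewrite [RHS](green_funE a_sum).
  by rewrite /delta; case: eqP Bw => [->//|_ _]; rewrite add0r.
have u0 w := green_fun_gt0 a_graph a_sum x w a_conn.
have Bz : gball a o (size t).+1%:R z by apply/gballP; exists t => //; rewrite ltr_nat.
have [h1 h2] := H _ (fun w _ => ltW (u0 w)) hx z Bz.
have d0 : 0 <= d.
  by rewrite mulr_ge0 ?exprn_ge0 ?subr_ge0 // invf_le1.
apply: le_trans de; rewrite (ger0_norm d0) ler_norml.
have : green_fun a x z / green_fun a x o <= 1 + d by rewrite ler_pdivrMr.
have : 1 - d <= green_fun a x z / green_fun a x o.
  (* The ratio is at least [1 / (1 + d)], hence at least [1 - d], because
     [(1 + d) * (1 - d) <= 1]. *)
  rewrite ler_pdivlMr // -(ler_pM2l (_ : 0 < 1 + d)); last by rewrite ltr_wpDr.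
  apply: le_trans h2; rewrite mulrA -[leRHS]mul1r ler_wpM2r ?(ltW (u0 o)) //.
  have := sqr_ge0 d; rewrite expr2; lra.
by move=> h3 h4; apply/andP; split; lra.
Qed.
End Harnack.

(** * The law of the walk *)

Section Measure.
Context d (T : measurableType d) (R : realType).
Implicit Types (mu : probability T R) (A B : set T).

Lemma le_measure_negligible mu A B : measurable A -> measurable B ->
  mu.-negligible (A `\` B) -> (mu A <= mu B)%E.
Proof.
move=> mA mB [N [mN N0 sub]]; rewrite -(measureU0 mB mN N0).
apply: le_measure; rewrite ?inE //; first exact: measurableU.
by move=> x Ax; have [Bx|nBx] := pselect (B x); [left|right; exact: sub].
Qed.

Lemma eq_measure_negligible mu A B : measurable A -> measurable B ->
  mu.-negligible (A `\` B) -> mu.-negligible (B `\` A) -> mu A = mu B.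
Proof.
by move=> mA mB AB BA; apply/eqP; rewrite eq_le !le_measure_negligible.
Qed.

Lemma measure_bigcup_seq mu (I : choiceType) (s : seq I) (F : I -> set T) : uniq s ->
  (forall i, measurable (F i)) -> trivIset [set` s] F ->
  mu (\bigcup_(i in [set` s]) F i) = (\sum_(i <- s) mu (F i))%E.
Proof.
move=> us mF tF; rewrite (measure_fin_bigcup mu) //.
exact/esym/fsbig_seq.
Qed.

Lemma measure_fibers mu (Y : T -> nat) B : measurable B ->
  (forall i, measurable (B `&` Y @^-1` [set i])) ->
  mu B = (\sum_(0 <= i <oo) mu (B `&` Y @^-1` [set i]))%E.
Proof.
move=> mB mY; rewrite -measure_semi_bigcup //.
- by congr (mu _); apply/seteqP; split=> [w Bw|w [i _ []//]]; exists (Y w).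
- by move=> i j _ _ [w [[_ <-] [_ <-]]].
- exact: bigcup_measurable.
Qed.

End Measure.

(** * First visit times as conditions on a single path *)

Section FirstVisit.
Context (R : realType) (V : countType) (T : Type) (X : nat -> T -> V).
Implicit Types (A B : set V) (w : T).
Local Notation fv := (first_visit R X).

Lemma first_visit_finP k0 A w :
  (fv k0 A w < +oo)%E <-> exists2 k, (k0 <= k)%N & A (X k w).
Proof.
split=> [/ereal_inf_lt[_ [k [k0k Ak] _] _]|[k k0k Ak]]; first by exists k.
apply: le_lt_trans (ltry k%:R); apply: ereal_inf_lbound; by exists k.
Qed.

(** The strict inequality forces [j] to run up to [k] included; the case where [B] is never visited
    is covered as well. *)
Lemma first_visit_ltP k0 k1 A B w : (fv k0 A w < fv k1 B w)%E <->
  exists k, [/\ (k0 <= k)%N, A (X k w) & forall j, (k1 <= j <= k)%N -> ~ B (X j w)].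
Proof.
split=> [/ereal_inf_lt[_ [k [k0k Ak] <-] kB]|[k [k0k Ak nB]]].
  exists k; split=> // j /andP[k1j jk] Bj; move: kB; apply/negP; rewrite -leNgt.
  apply: le_trans (_ : ((j%:R : R)%:E <= _)%E); last by rewrite lee_fin ler_nat.
  by apply: ereal_inf_lbound; exists j.
apply: (@le_lt_trans _ _ (k%:R : R)%:E); first by apply: ereal_inf_lbound; exists k.
apply: (@lt_le_trans _ _ (k.+1%:R : R)%:E); first by rewrite lte_fin ltr_nat.
apply: le_ereal_inf_tmp => _ [j [k1j Bj] <-]; rewrite lee_fin ler_nat ltnNge.
by apply/negP => jk; apply: (nB j) => //; rewrite k1j.
Qed.

Lemma first_visit_eqP k0 A w k : fv k0 A w = (k%:R : R)%:E <->
  [/\ (k0 <= k)%N, A (X k w) & forall j, (k0 <= j < k)%N -> ~ A (X j w)].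
Proof.
split=> [E|[k0k Ak nA]].
  have nA j : (k0 <= j < k)%N -> ~ A (X j w).
    move=> /andP[k0j jk] Aj.
    have : (fv k0 A w <= (j%:R : R)%:E)%E by apply: ereal_inf_lbound; exists j.
    by rewrite E lee_fin ler_nat leqNgt jk.
  have : (fv k0 A w < (k.+1%:R : R)%:E)%E by rewrite E lte_fin ltr_nat.
  move=> /ereal_inf_lt[_ [j [k0j Aj] <-]]; rewrite lte_fin ltr_nat ltnS => jk.
  suff <- : j = k by split=> // i ij; apply: nA; move: ij => /andP[-> /leq_trans->].
  apply/eqP; rewrite eqn_leq jk leqNgt; apply/negP => jk'.
  by apply: (nA j) => //; rewrite k0j.
apply/eqP; rewrite eq_le; apply/andP; split; first by apply: ereal_inf_lbound; exists k.
apply: le_ereal_inf_tmp => _ [j [k0j Aj] <-]; rewrite lee_fin ler_nat leqNgt.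
by apply/negP => jk; apply: (nA j) => //; rewrite k0j.
Qed.
End FirstVisit.

(** * The Markov property and the laws of the walk *)

Section Walk.
Context (R : realType) (V : countType) (a : V -> V -> R).
Context d (T : measurableType d) (P : V -> probability T R) (X : nat -> T -> V).
Hypotheses (a_graph : weighted_graph a) (X_walk : random_walk a P X).
Implicit Types (E : set T) (x y z : V) (s : seq V).

(** Events of the natural filtration at time [n], described by saturation under equal trajectories.
    As [V] is countable, this already implies measurability. *)
Definition adapted n E := forall w w',
  (forall k, (k <= n)%N -> X k w = X k w') -> E w -> E w'.

Lemma adaptedW m n E : (m <= n)%N -> adapted m E -> adapted n E.
Proof. by move=> mn aE w w' ww'; apply: aE => k km; apply: ww'; exact: leq_trans mn. Qed.

Lemma adaptedI n E F : adapted n E -> adapted n F -> adapted n (E `&` F).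
Proof. by move=> aE aF w w' ww' [Ew Fw]; split; [exact: aE Ew|exact: aF Fw]. Qed.

Lemma adapted_eq n z : adapted n [set w | X n w = z].
Proof. by move=> w w' ww' /= <-; rewrite ww'. Qed.

(** Coding the trajectory by a natural number cuts an adapted event into countably many pieces, each
    empty or a cylinder. *)
Definition traj n w : nat := choice.pickle [seq X k w | k <- iota 0 n.+1].

Lemma traj_eqP n w w' : traj n w = traj n w' <-> forall k, (k <= n)%N -> X k w = X k w'.
Proof.
split=> [/(pcan_inj choice.pickleK) E k kn|E]; last first.
  by congr choice.pickle; apply/eq_in_map => k; rewrite mem_iota add0n ltnS; exact: E.
have := congr1 (fun t => nth (X 0 w) t k) E.
by rewrite !(nth_map 0%N) ?size_iota ?ltnS // nth_iota.
Qed.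

Lemma measurable_cylinder n (z : nat -> V) :
  measurable [set w | forall k, (k <= n)%N -> X k w = z k].
Proof.
have -> : [set w | forall k, (k <= n)%N -> X k w = z k]
    = \bigcap_(k in [set k | (k <= n)%N]) [set w | X k w = z k].
  by apply/seteqP; split.
by apply: bigcap_measurableType => k _; exact: (rw_measurable X_walk).
Qed.

Lemma adapted_fiber n E i : adapted n E ->
  E `&` traj n @^-1` [set i] = set0 \/
  exists w, E w /\ E `&` traj n @^-1` [set i]
    = [set w' | forall k, (k <= n)%N -> X k w' = X k w].
Proof.
move=> aE; have [->|/set0P[w [Ew /= iw]]] := eqVneq (E `&` traj n @^-1` [set i]) set0.
  by left.
right; exists w; split=> //; apply/seteqP; split=> w' /=.
  by move=> [_]; rewrite -iw => /traj_eqP.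
move=> ww'; split; first by apply: aE Ew => k kn; rewrite ww'.
by rewrite -iw; apply/traj_eqP.
Qed.

Lemma measurable_adapted_fiber n E i : adapted n E ->
  measurable (E `&` traj n @^-1` [set i]).
Proof.
by move=> /(@adapted_fiber n E i)[->//|[w [_ ->]]]; exact: measurable_cylinder.
Qed.

Lemma measurable_adapted n E : adapted n E -> measurable E.
Proof.
move=> aE.
have -> : E = \bigcup_i (E `&` traj n @^-1` [set i]).
  by apply/seteqP; split=> [w Ew|w [i _ []//]]; exists (traj n w).
by apply: bigcupT_measurable => i; exact: measurable_adapted_fiber.
Qed.

Lemma measurable_bigcup_adapted (t : nat -> nat) (E : nat -> set T) :
  (forall n, adapted (t n) (E n)) -> measurable [set w | exists n, E n w].
Proof.
move=> aE; rewrite (_ : mkset _ = \bigcup_n E n); last first.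
  by apply/seteqP; split=> w [n]; [exists n|move=> _; exists n].
by apply: bigcupT_measurable => n; exact: measurable_adapted (aE n).
Qed.

(** The axiom [rw_step] speaks of cylinders only; it is applied on each fiber of [traj n] and the
    results are summed. *)
Lemma markov_step x n E z y : adapted n E -> (forall w, E w -> X n w = z) ->
  P x (E `&` [set w | X n.+1 w = y]) = (P x E * (trans_prob a z y)%:E)%E.
Proof.
move=> aE Ez; have mE := measurable_adapted aE.
have my := rw_measurable X_walk n.+1 y.
rewrite (measure_fibers (P x) (Y := traj n) (measurableI _ _ mE my)); last first.
  by move=> i; rewrite setIAC; apply: measurableI => //; exact: measurable_adapted_fiber.
rewrite (measure_fibers (P x) (Y := traj n) mE); last first.
  by move=> i; exact: measurable_adapted_fiber.
rewrite muleC -nneseriesZl; last by move=> i _; exact: measure_ge0.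
apply: eq_eseriesr => i _; rewrite setIAC muleC.
have [->|[w [Ew ->]]] := adapted_fiber i aE; first by rewrite set0I measure0 mul0e.
by rewrite (rw_step X_walk) (Ez w Ew).
Qed.

(** Sample paths follow edges only almost surely: each fiber lies in a two-time event whose
    probability has a vanishing transition probability as a factor. *)
Lemma negligible_not_adj x n : (P x).-negligible [set w | ~ adj a (X n w) (X n.+1 w)].
Proof.
have aN : adapted n.+1 [set w | ~ adj a (X n w) (X n.+1 w)].
  by move=> w w' ww' /=; rewrite !ww'.
have mN := measurable_adapted aN.
suff N0 : P x [set w | ~ adj a (X n w) (X n.+1 w)] = 0%E by exact/negligibleP.
rewrite (measure_fibers (P x) (Y := traj n.+1) mN); last first.
  by move=> i; exact: measurable_adapted_fiber.
apply: eseries0 => i _ _; have [->|[w [Ew iE]]] := adapted_fiber i aN.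
  exact: measure0.
have : P x ([set w' | X n w' = X n w] `&` [set w' | X n.+1 w' = X n.+1 w]) = 0%E.
  rewrite (@markov_step _ _ _ (X n w)) //; last exact: adapted_eq.
  by rewrite trans_prob_nadj ?mule0 // mem_nbrs //; apply/negP.
apply: subset_measure0; first exact: measurable_adapted_fiber.
  by apply: measurableI; exact: (rw_measurable X_walk).
by rewrite iE => w' ww'; split; apply: ww'.
Qed.

Lemma negligible_start x : (P x).-negligible [set w | X 0 w <> x].
Proof.
have m0 := rw_measurable X_walk 0 x.
apply/negligibleP; first exact: measurableC.
by have := probability_setC (P x) m0; rewrite (rw_start X_walk) subee.
Qed.

Lemma start_law x y : P x [set w | X 0 w = y] = (delta y x)%:E.
Proof.
rewrite /delta; case: eqP => [->|xy]; first exact: (rw_start X_walk).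
have m0 := rw_measurable X_walk 0 y.
apply/negligibleP => //; apply: negligibleS (negligible_start x) => w /= ->; exact/nesym.
Qed.

Definition avoids s n := [set w | forall k, (0 < k <= n)%N -> X k w \notin s].

Lemma adapted_avoids s n : adapted n (avoids s n).
Proof. by move=> w w' ww' nw k /andP[k0 kn]; rewrite -ww' //; apply: nw; rewrite k0. Qed.

(** The bridge from the walk to the operators. The event is split by the position before the last
    step, almost surely a neighbour of [y]; a position in [s] contributes nothing, as in
    [kill_kernelS]. *)
Lemma avoids_law s x n y :
  P x (avoids s n `&` [set w | X n.+1 w = y]) = (kill_kernel a s n x y)%:E.
Proof.
elim: n y => [|n IHn] y.
  have m0 := rw_measurable X_walk 0 x; have m1 := rw_measurable X_walk 1 y.
  have -> : avoids s 0 = setT by apply/seteqP; split=> // w _ [].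
  rewrite setTI /kill_kernel /= trans_op_delta //.
  transitivity (P x ([set w | X 0 w = x] `&` [set w | X 1 w = y])).
    apply: eq_measure_negligible => //; first exact: measurableI.
      apply: negligibleS (negligible_start x) => w [/= h1 h2] h0; exact: h2.
    by apply: negligibleS (negligible_start x) => w [[]].
  rewrite (@markov_step _ _ _ x) //; last exact: adapted_eq.
  by rewrite (rw_start X_walk) mul1e.
have aS : adapted n.+1 (avoids s n.+1) by exact: adapted_avoids.
have az z : adapted n.+1 (avoids s n.+1 `&` [set w | X n.+1 w = z]).
  by apply: adaptedI => //; exact: adapted_eq.
have my := rw_measurable X_walk n.+2 y.
pose F z := avoids s n.+1 `&` [set w | X n.+1 w = z] `&` [set w | X n.+2 w = y].
have mF z : measurable (F z).
  by apply: measurableI => //; exact: measurable_adapted (az z).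
transitivity (P x (\bigcup_(z in [set` nbrs a y]) F z)).
  apply: eq_measure_negligible.
  - by apply: measurableI => //; exact: measurable_adapted aS.
  - by apply: fin_bigcup_measurable.
  - apply: negligibleS (negligible_not_adj x n.+1) => w [[/= nw wy] nF] h; apply: nF.
    by exists (X n.+1 w) => //=; rewrite nbrsC // mem_nbrs // -wy.
  - rewrite (_ : _ `\` _ = set0); first exact: negligible_set0.
    by apply/seteqP; split=> // w [[z _ [[nw _] wy]]]; apply; split.
rewrite measure_bigcup_seq ?nbrs_uniq //; last first.
  by move=> z z' _ _ [w [[[_ <-] _] [[_ <-] _]]].
rewrite kill_kernelS // -sumEFin; apply: eq_bigr => z _.
rewrite /F (@markov_step x n.+1 _ z y (az z)); last by move=> w [].
case: ifPn => zs.
  rewrite (_ : _ `&` _ = set0) ?measure0 ?mul0e ?mul0r //.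
  apply/seteqP; split=> // w [nw wz]; have := nw n.+1 (leqnn _).
  by rewrite (wz : X n.+1 w = z) zs.
rewrite (_ : _ `&` _ = avoids s n `&` [set w | X n.+1 w = z]).
  by rewrite IHn -EFinM mulrC.
apply/seteqP; split=> w [nw wz]; split=> // k /andP[k0].
  by move=> kn; apply: nw; rewrite k0 ltnW.
rewrite leq_eqVlt => /orP[/eqP->|kn]; first by rewrite (wz : X n.+1 w = z).
by apply: nw; rewrite k0.
Qed.

Lemma walk_law x n y : P x [set w | X n w = y] = (iter n (trans_op a) (delta y) x)%:E.
Proof.
case: n => [|n]; first exact: start_law.
have := avoids_law [::] x n y; rewrite /kill_kernel killed_op_nil -iterSr => <-.
by congr (P x _); apply/seteqP; split=> [w|w []].
Qed.

Lemma transient_summable x y : connected_graph a -> transient P X ->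
  cvgn (series (fun n => iter n (trans_op a) (delta y) x)).
Proof.
move=> a_conn [x0 [y0]]; rewrite /green.
under eq_eseriesr do rewrite walk_law.
move=> /nnseries_is_cvg cv; apply: (@series_iter_trans_op_cvg _ _ _ a_graph x0 y0 x y a_conn).
by apply: cv => n; exact: iter_trans_op_delta_ge0.
Qed.

End Walk.

(** * Hitting and escape probabilities *)

Section Hitting.
Context (R : realType) (V : countType) (a : V -> V -> R).
Context d (T : measurableType d) (P : V -> probability T R) (X : nat -> T -> V).
Hypotheses (a_graph : weighted_graph a) (X_walk : random_walk a P X).
Hypotheses (a_conn : connected_graph a) (X_trans : transient P X).
Variable s : seq V.
Hypothesis s_uniq : uniq s.
Implicit Types (x y z : V) (E : set T).

Local Notation tauA := (tau R X [set` s]).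
Local Notation K := (killed_green a s).

Lemma fine_measure_le x E F : measurable E -> measurable F -> E `<=` F ->
  fine (P x E) <= fine (P x F).
Proof.
move=> mE mF EF; apply: fine_le; rewrite ?(fin_num_measure (P x)) //.
by apply: le_measure; rewrite ?inE.
Qed.

Lemma nneseries_EFin (f : nat -> R) : cvgn (series f) ->
  (\sum_(0 <= n <oo) (f n)%:E)%E = (limn (series f))%:E.
Proof.
move=> cf; rewrite -EFin_lim //; congr (limn _).
by apply/funext => n /=; rewrite seriesEnat /= sumEFin.
Qed.

(** For [y] in [s], this says that [tauA] equals [n.+1] with the walk at [y] at that time. *)
Definition first_hit n y := avoids X s n `&` [set w | X n.+1 w = y].

Lemma adapted_first_hit n y : adapted X n.+1 (first_hit n y).
Proof.
apply: adaptedI; last exact: adapted_eq.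
by apply: (adaptedW (m := n)) => //; exact: adapted_avoids.
Qed.

Lemma first_hit_inj n n' y y' w : y \in s -> y' \in s ->
  first_hit n y w -> first_hit n' y' w -> n = n' /\ y = y'.
Proof.
move=> ys ys' [nw wy] [nw' wy'].
suff nn' : n = n' by split=> //; rewrite -wy -wy' nn'.
case: (ltngtP n n') => // lt.
  by have := nw' n.+1 lt; rewrite (wy : X n.+1 w = y) ys.
by have := nw n'.+1 lt; rewrite (wy' : X n'.+1 w = y') ys'.
Qed.

Lemma hitE y : y \in s ->
  [set w | exists2 k, tauA w = k%:R%:E & X k w = y] = \bigcup_n first_hit n y.
Proof.
move=> ys; apply/seteqP; split=> [w [k /first_visit_eqP[k0 _ nA] wy]|w [n _ [nw wy]]].
  case: k k0 nA wy => // n _ nA wy; exists n => //; split=> // j /andP[j0 jn].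
  by apply/negP; apply: nA; rewrite j0.
exists n.+1 => //; apply/first_visit_eqP; split=> //=; first by rewrite (wy : X n.+1 w = y).
by move=> j /andP[j0 jn]; apply/negP; apply: nw; rewrite j0.
Qed.

Lemma measurable_hit y : measurable (\bigcup_n first_hit n y).
Proof.
by apply: bigcupT_measurable => n; apply: (measurable_adapted X_walk); exact: adapted_first_hit.
Qed.

Lemma summable x y : cvgn (series (fun n => iter n (trans_op a) (delta y) x)).
Proof. exact: transient_summable X_trans. Qed.

Lemma hit_law x y : y \in s -> P x (\bigcup_n first_hit n y) = (K x y)%:E.
Proof.
move=> ys; rewrite measure_semi_bigcup //.
- transitivity (\sum_(0 <= n <oo) (kill_kernel a s n x y)%:E)%E.
    by apply: eq_eseriesr => n _; exact: (avoids_law a_graph X_walk).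
  by rewrite nneseries_EFin //; apply: (killed_green_cvg a_graph) => ? ?; exact: summable.
- move=> n; apply: (measurable_adapted X_walk); exact: adapted_first_hit.
- by move=> n n' _ _ [w [h h']]; have [] := first_hit_inj ys ys h h'.
- exact: measurable_hit.
Qed.

Lemma tau_finE : [set w | (tauA w < +oo)%E] =
  \bigcup_(y in [set` s]) \bigcup_n first_hit n y.
Proof.
apply/seteqP; split=> w; last first.
  move=> [y /= ys]; rewrite -hitE // => -[k kE _]; by rewrite kE ltry.
move=> /first_visit_finP[k k0 /= ks].
have ex : exists k, (0 < k)%N && (X k w \in s) by exists k; rewrite k0.
case: (ex_minnP ex) => -[//|n] /andP[_ ns] nmin; exists (X n.+1 w) => //; exists n => //.
split=> // j /andP[j0 jn]; apply/negP => js.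
by have := nmin j; rewrite j0 js ltnNge jn => /(_ isT).
Qed.

Lemma measurable_tau_fin : measurable [set w | (tauA w < +oo)%E].
Proof.
by rewrite tau_finE; apply: fin_bigcup_measurable => // y _; exact: measurable_hit.
Qed.

Lemma tau_fin_law x : P x [set w | (tauA w < +oo)%E] = (\sum_(y <- s) K x y)%:E.
Proof.
rewrite tau_finE measure_bigcup_seq //; first last.
- by move=> y y' ys ys' [w [[n _ h] [n' _ h']]]; have [] := first_hit_inj ys ys' h h'.
- exact: measurable_hit.
by rewrite -sumEFin; apply: eq_big_seq => y ys; exact: hit_law.
Qed.

Lemma hit_probE x : hit_prob P X [set` s] x = \sum_(y <- s) K x y.
Proof. by rewrite /hit_prob tau_fin_law. Qed.

Lemma hitting_lawE x y : y \in s ->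
  hitting_law P X [set` s] x y = K x y / \sum_(z <- s) K x z.
Proof. by move=> ys; rewrite /hitting_law hit_probE hitE // hit_law. Qed.

(** A first step to a neighbour [z] precedes the passage from [z] to [y], so the visit has a time at
    least 1 even when [x = y]. *)
Lemma hit_prob_gt0 x y : y \in s -> 0 < hit_prob P X [set` s] x.
Proof.
move=> ys; have : exists z, z \in nbrs a x.
  case E : (nbrs a x) => [|z t]; last by exists z; rewrite mem_head.
  by have /eqP := trans_op_sum1 a_graph x; rewrite E big_nil eq_sym oner_eq0.
move=> [z]; rewrite mem_nbrs // => xz; have [n nz] := connected_walk a_graph z y a_conn.
have gt0 : 0 < iter n.+1 (trans_op a) (delta y) x.
  apply: lt_le_trans (iter_trans_op_lb a_graph (u := iter n (trans_op a) (delta y)) 1 z x _).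
    by rewrite mulr_gt0 //= trans_op_delta // trans_prob_gt0.
  by move=> w; exact: iter_trans_op_delta_ge0.
apply: (lt_le_trans gt0).
have -> : iter n.+1 (trans_op a) (delta y) x = fine (P x [set w | X n.+1 w = y]).
  by rewrite (walk_law a_graph X_walk).
apply: fine_measure_le; [exact: (rw_measurable X_walk)|exact: measurable_tau_fin|].
by move=> w /= wy; apply/first_visit_finP; exists n.+1 => //=; rewrite wy.
Qed.

Definition escape x := 1 - \sum_(y <- s) K x y.

Definition never_hits := [set w | forall k, (0 < k)%N -> X k w \notin s].

Lemma neverE : never_hits = ~` [set w | (tauA w < +oo)%E].
Proof.
apply/seteqP; split=> [w nw /first_visit_finP[k k0 ks]|w nf k k0].
  by have := nw k k0; rewrite ks.
by apply/negP => ks; apply: nf; apply/first_visit_finP; exists k.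
Qed.

Lemma measurable_never : measurable never_hits.
Proof. by rewrite neverE; apply: measurableC; exact: measurable_tau_fin. Qed.

Lemma never_law x : fine (P x never_hits) = escape x.
Proof. by rewrite neverE probability_setC ?tau_fin_law //; exact: measurable_tau_fin. Qed.

Lemma escape_ge0 x : 0 <= escape x.
Proof. by rewrite -never_law fine_ge0. Qed.

(** * Escape probabilities as limits along an exhaustion *)

Section Exhaustion.
Variable B : nat -> set V.
Hypothesis B_mono : forall m m', (m <= m')%N -> B m `<=` B m'.
Hypothesis B_near : forall y, \forall m \near \oo, B m y.

(** The error event: the walk does come to [s] after time 0, but has been outside [B m] by then. *)
Definition exits m := [set w | exists n, avoids X s n w /\
  X n.+1 w \in s /\ exists2 j, (j <= n.+1)%N & ~ B m (X j w)].

Lemma measurable_exits m : measurable (exits m).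
Proof.
apply: (measurable_bigcup_adapted X_walk (t := succn) (E := fun n =>
  [set w | avoids X s n w /\ X n.+1 w \in s /\
    exists2 j, (j <= n.+1)%N & ~ B m (X j w)])) => n w w' ww' [nw [ws [j jn Bj]]].
split; first by apply: (adapted_avoids (n := n)) nw => k kn; apply: ww'; exact: leqW.
by split; [rewrite -ww'|exists j => //; rewrite -ww'].
Qed.

(** Up to its first visit to [s] a path has finitely many positions, all in [B m] for large [m]. So
    the decreasing events have empty intersection. *)
Lemma exits_cvg0 x : fine (P x (exits m)) @[m --> \oo] --> (0 : R).
Proof.
have E0 : \bigcap_m exits m = set0.
  apply/seteqP; split=> // w wE.
  have [n [nw [ws _]]] := wE 0%N I.
  have : \forall m \near \oo, forall j : 'I_n.+2, B m (X j w).
    by apply: filter_forall => j; exact: B_near.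
  move=> [m _ /(_ m (leqnn m)) /= Bm].
  have [n' [nw' [ws' [j jn Bj]]]] := wE m I.
  have [nn' _] : n = n' /\ X n.+1 w = X n'.+1 w.
    by apply: (@first_hit_inj n n' _ _ w).
  by apply: Bj; have := Bm (Ordinal (_ : j < n.+2)%N); apply; rewrite nn' ltnS.
have mE := measurable_exits.
have : (P x \o exits) m @[m --> \oo] --> P x (\bigcap_m exits m).
  apply: nonincreasing_cvg_mu => //; last 2 first.
  - by rewrite E0.
  - move=> m m' mm'; apply/subsetPset => w [n [nw [ws [j jn Bj]]]].
    by exists n; split=> //; split=> //; exists j => // /(B_mono mm').
  by rewrite ltey_eq fin_num_measure.
rewrite E0 measure0 => h.
by apply: (@fine_cvg _ _ _ _ (fun m => P x (exits m))); exact: h.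
Qed.

(** A squeeze: up to null sets, [D m] eventually lies between [never_hits] and its union with the
    error event. *)
Lemma escape_cvg x (D : nat -> set T) : (forall m, measurable (D m)) ->
  (forall m, D m `<=` never_hits `|` exits m) ->
  (\forall m \near \oo, (P x).-negligible (never_hits `\` D m)) ->
  fine (P x (D m)) @[m --> \oo] --> escape x.
Proof.
move=> mD Dsub nD; have mN := measurable_never.
have h : escape x + fine (P x (exits m)) @[m --> \oo] --> escape x.
  rewrite -[X in _ --> X]addr0; apply: cvgD; [exact: cvg_cst|exact: exits_cvg0].
apply: (squeeze_cvgr _ (cvg_cst (escape x)) h); near=> m.
rewrite -never_law; apply/andP; split.
  apply: fine_le; rewrite ?fin_num_measure //; apply: le_measure_negligible => //.
  by near: m.
have mE := measurable_exits m.
rewrite -fineD ?fin_num_measure //; apply: fine_le.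
- exact: fin_num_measure.
- by rewrite fin_numD !fin_num_measure.
apply: (le_trans _ (measureU2 _ mN mE)).
by apply: le_measure; rewrite ?inE //; exact: measurableU.
Unshelve. all: by end_near. Qed.

(** Both events of the statement have this form: [k0 = 0] with the complement of a ball for the
    capacity, [k0 = 1] with its boundary for the escape law. *)
Definition exit_first (k0 : nat) (Q : set V) :=
  [set w | (first_visit R X k0 Q w < tauA w)%E].

Lemma measurable_exit_first k0 Q : measurable (exit_first k0 Q).
Proof.
rewrite (_ : exit_first k0 Q = [set w | exists k, [/\ (k0 <= k)%N, Q (X k w)
    & forall j, (1 <= j <= k)%N -> ~ [set` s] (X j w)]]); last first.
  by apply/seteqP; split=> w; have [lt_ex ex_lt] := first_visit_ltP R X k0 1 Q [set` s] w;
    [exact: lt_ex|exact: ex_lt].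
apply: (measurable_bigcup_adapted X_walk (t := id) (E := fun k =>
  [set w | [/\ (k0 <= k)%N, Q (X k w)
    & forall j, (1 <= j <= k)%N -> ~ [set` s] (X j w)]])) => k w w' ww' [k0k Qk nA].
split=> //; first by rewrite -ww'.
by move=> j /andP[j0 jk]; rewrite -ww' //; apply: nA; rewrite j0.
Qed.

Lemma exit_first_sub k0 Q m : Q `<=` ~` B m ->
  exit_first k0 Q `<=` never_hits `|` exits m.
Proof.
move=> QB w /first_visit_ltP[k [_ Qk nA]].
have [nw|/existsNP[l /not_implyP[l0 /negP/negPn ls]]] := pselect (never_hits w); first by left.
have ex : exists k, (0 < k)%N && (X k w \in s) by exists l; rewrite l0.
right; case: (ex_minnP ex) => -[//|n] /andP[_ ns] nmin; exists n; split.
  move=> j /andP[j0 jn]; apply/negP => js.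
  by have := nmin j; rewrite j0 js ltnNge jn => /(_ isT).
split=> //; exists k; last exact: QB.
by rewrite leqNgt; apply/negP => nk; apply: (nA n.+1) => //=; rewrite ltnW.
Qed.

End Exhaustion.

(** Staying in [B] implies being in [B] at time [n], whose probability is a finite sum of general
    terms of convergent Green series. *)
Lemma negligible_stay x (B : set V) : finite_set B ->
  (P x).-negligible [set w | forall k, B (X k w)].
Proof.
move=> /finite_fsetP[F ->].
have mS : measurable [set w | forall k, [set` F] (X k w)].
  rewrite (_ : mkset _ = ~` [set w | exists k, ~ [set` F] (X k w)]); last first.
    by apply/seteqP; split=> [w Fw [k]|w nF k]; [apply|apply: contrapT => h; apply: nF; exists k].
  apply: measurableC; apply: (measurable_bigcup_adapted X_walk (t := id)
    (E := fun k => [set w | ~ [set` F] (X k w)])) => k.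
  by move=> w w' ww' /=; rewrite ww'.
apply/negligibleP => //.
have le n : fine (P x [set w | forall k, [set` F] (X k w)])
    <= \sum_(z <- enum_fset F) iter n (trans_op a) (delta z) x.
  have -> : \sum_(z <- enum_fset F) iter n (trans_op a) (delta z) x =
      fine (P x (\bigcup_(z in [set` enum_fset F]) [set w | X n w = z])).
    rewrite measure_bigcup_seq ?fset_uniq //.
    - rewrite (eq_bigr (fun z => (iter n (trans_op a) (delta z) x)%:E)) ?sumEFin // => z _.
      exact: (walk_law a_graph X_walk).
    - by move=> z; exact: (rw_measurable X_walk).
    - by move=> z z' _ _ [w [<- <-]].
  apply: fine_measure_le => //.
    by apply: fin_bigcup_measurable => // z _; exact: (rw_measurable X_walk).
  by move=> w /(_ n) wF; exists (X n w).
have c0 : \sum_(z <- enum_fset F) iter n (trans_op a) (delta z) x @[n --> \oo] --> (0 : R).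
  rewrite [X in _ --> X](_ : 0 = \sum_(z <- enum_fset F) (0 : R)); last by rewrite big1.
  apply: cvg_big => [|z _]; first exact: add_continuous.
  have h := cvg_series_cvg_0 (@summable x z); exact: h.
rewrite -[LHS]fineK ?fin_num_measure //; congr EFin; apply/eqP.
rewrite eq_le fine_ge0 // andbT.
by apply: (ler_cvg_to (cvg_cst _) c0); near=> n; exact: le.
Unshelve. all: by end_near. Qed.

(** Outside a null set the path starts at [x], follows edges and leaves [B]. In the boundary case, a
    path from [B] along edges that never meets the boundary would stay in [B], by induction on
    time. *)
Lemma negligible_never_exit x (B Q : set V) k0 : B x -> finite_set B ->
  ((k0 = 0%N) /\ Q = ~` B) \/ ((k0 = 1%N) /\ Q = boundary a B) ->
  (P x).-negligible (never_hits `\` exit_first k0 Q).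
Proof.
move=> Bx B_fin kQ.
pose N := [set w | X 0 w <> x] `|` \bigcup_n [set w | ~ adj a (X n w) (X n.+1 w)]
  `|` [set w | forall k, B (X k w)].
have nN : (P x).-negligible N.
  apply: negligibleU; last exact: negligible_stay.
  apply: negligibleU; first exact: (negligible_start X_walk).
  by apply: negligible_bigcup => n; exact: (negligible_not_adj a_graph X_walk).
apply: negligibleS nN => w [nw nexit].
have nQ k : (k0 <= k)%N -> ~ Q (X k w).
  move=> kk Qk; apply: nexit; apply/first_visit_ltP; exists k; split=> // j /andP[j0 _].
  by apply/negP; exact: nw.
have [w0|] := pselect (X 0%N w = x); last by move=> ?; left; left.
have [wadj|/existsNP[n ?]] := pselect (forall n, adj a (X n w) (X n.+1 w)); last first.
  by left; right; exists n.
right=> /=; case: kQ nQ => -[-> ->] nQ; first by move=> k; apply: contrapT; exact: nQ.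
elim=> [|k IHk]; first by rewrite w0.
by apply: contrapT => nB; apply: (nQ k.+1) => //; split=> //; exists (X k w).
Qed.

End Hitting.

(** * Limits *)

Section Limits.
Context (R : realType) (V : countType) (a : V -> V -> R).
Context d (T : measurableType d) (P : V -> probability T R) (X : nat -> T -> V).
Hypotheses (a_graph : weighted_graph a) (X_walk : random_walk a P X).
Hypotheses (a_conn : connected_graph a) (X_trans : transient P X).
Variable s : seq V.
Hypothesis s_uniq : uniq s.
Local Notation pi := (vweight a).
Local Notation K := (killed_green a s).
Local Notation e := (escape a s).
Local Notation A := [set` s].

Let green_summable x z : cvgn (series (fun n => iter n (trans_op a) (delta x) z)).
Proof. exact: transient_summable X_trans. Qed.

(** If the sum vanished, so would each of its nonnegative terms, and [last_exit] would give
    [pi y = 0]. *)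
Lemma sum_escape_gt0 y : y \in s -> 0 < \sum_(z <- s) pi z * e z.
Proof.
move=> ys; have e0 := escape_ge0 a_graph X_walk a_conn X_trans s_uniq.
have t0 z : 0 <= pi z * e z by rewrite mulr_ge0 // ltW // (wg_vweight_gt0 a_graph).
rewrite lt_neqAle sumr_ge0 ?andbT //; apply/eqP => /esym/eqP.
rewrite psumr_eq0 // => /allP s0.
have := wg_vweight_gt0 a_graph y; rewrite (last_exit a_graph green_summable s_uniq ys).
rewrite big_seq big1 ?ltxx // => z zs.
by have /eqP := s0 z zs; rewrite /escape => ->; rewrite mul0r.
Qed.

Lemma gball_escape_cvg x0 y (D : nat -> set V) k0 :
  ((k0 = 0%N) /\ D = fun m => ~` gball a x0 m%:R) \/
  ((k0 = 1%N) /\ D = fun m => boundary a (gball a x0 m%:R)) ->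
  fine (P y (exit_first R X s k0 (D m))) @[m --> \oo] --> e y.
Proof.
move=> kD; have mono m m' : (m <= m')%N -> gball a x0 m%:R `<=` gball a x0 m'%:R.
  by move=> mm'; apply: gball_le; rewrite ler_nat.
apply: (escape_cvg a_graph X_walk a_conn X_trans s_uniq mono) => [z|m|m|].
- exact: gball_near.
- exact: (measurable_exit_first X_walk).
- by apply: (exit_first_sub (B := fun m => gball a x0 m%:R)) => z; case: kD => -[_ ->] // [].
- near=> m; apply: (negligible_never_exit a_graph X_walk a_conn X_trans s
    (B := gball a x0 m%:R)).
  + by near: m; exact: gball_near.
  + exact: finite_gball.
  + by case: kD => -[-> ->]; [left|right].
Unshelve. all: by end_near. Qed.

Lemma capacity_cvg x0 :
  capacity a P X (gball a x0 m%:R) A @[m --> \oo] --> \sum_(z <- s) pi z * e z.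
Proof.
rewrite /capacity; under eq_fun do rewrite -fsbig_seq //.
apply: cvg_big => [|z _]; first exact: add_continuous.
apply: cvgM; first exact: cvg_cst.
apply: (@gball_escape_cvg x0 z (fun m => ~` gball a x0 m%:R) 0%N); by left.
Qed.

Lemma escape_law_cvg x0 y : y \in s ->
  escape_law a P X A x0 m y @[m --> \oo] --> pi y * e y / \sum_(z <- s) pi z * e z.
Proof.
move=> ys; apply: cvgM; last first.
  by apply: cvgV; [rewrite gt_eqF // (sum_escape_gt0 ys)|exact: capacity_cvg].
apply: cvgM; first exact: cvg_cst.
apply: (@gball_escape_cvg x0 y (fun m => boundary a (gball a x0 m%:R)) 1%N); by right.
Qed.

Lemma killed_green_ratio_cvg C o z : 1 <= C -> weak_harnack a C -> o \in s -> z \in s ->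
  K z x / green_fun a x o @[x --> far_from a A] --> e z.
Proof.
move=> C1 wH os zs; have Ao : A o by [].
have gr w := green_ratio_cvg a_graph o w a_conn Ao C1 wH green_summable.
have : green_fun a x z / green_fun a x o - \sum_(w <- s) K z w * (green_fun a x w / green_fun a x o)
    @[x --> far_from a A] --> e z.
  have -> : e z = 1 - \sum_(w <- s) K z w * 1.
    by rewrite /escape; under [in RHS]eq_bigr do rewrite mulr1.
  apply: cvgB; first exact: gr.
  apply: cvg_big => [|w _]; first exact: add_continuous.
  by apply: cvgM; [exact: cvg_cst|exact: gr].
apply: cvg_trans; apply: near_eq_cvg.
have := far_from_notin a_conn Ao (finite_seq s).
(* For [x] outside [s] the delta term vanishes, and the decomposition leaves exactly [K z x] after
   the sum over [s] is subtracted. *)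
apply: filterS => x /negP xs.
have zx : delta x z = 0 :> R by rewrite /delta; case: eqP xs => // <-; rewrite zs.
rewrite [green_fun a x z](green_funE green_summable) zx add0r.
rewrite (killed_green_decomp a_graph green_summable x z s_uniq).
rewrite (negPf xs) mulrDl mulr_suml addrAC -sumrB big1 ?add0r // => w _.
by rewrite mulrA [K z w * _]mulrC subrr.
Qed.

Lemma hitting_law_cvg C y : 1 <= C -> weak_harnack a C -> y \in s ->
  hitting_law P X A x y @[x --> far_from a A] -->
    pi y * e y / \sum_(z <- s) pi z * e z.
Proof.
move=> C1 wH ys.
have h z : z \in s -> pi z * (K z x / green_fun a x y) @[x --> far_from a A] --> pi z * e z.
  by move=> zs; apply: cvgM; [exact: cvg_cst|exact: killed_green_ratio_cvg C1 wH ys zs].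
have : pi y * (K y x / green_fun a x y) / \sum_(z <- s) pi z * (K z x / green_fun a x y)
    @[x --> far_from a A] --> pi y * e y / \sum_(z <- s) pi z * e z.
  apply: cvgM; first exact: h.
  apply: cvgV; first by rewrite gt_eqF // (sum_escape_gt0 ys).
  rewrite big_seq; under eq_fun do rewrite big_seq.
  by apply: cvg_big => [|z zs]; [exact: add_continuous|exact: h].
apply: cvg_trans; apply: near_eq_cvg; apply: nearW => x.
rewrite (hitting_lawE a_graph X_walk a_conn X_trans s_uniq) //.
have g0 : green_fun a x y != 0 by rewrite gt_eqF // (green_fun_gt0 a_graph green_summable).
have c0 : pi x / green_fun a x y != 0 by rewrite mulf_neq0 ?invr_eq0 ?vweight_neq0.
(* Reversibility exchanges start and end at the cost of a factor that does not depend on [z], which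
   cancels in the quotient. *)
have E z : pi z * (K z x / green_fun a x y) = pi x / green_fun a x y * K x z.
  by rewrite mulrA (killed_green_sym a_graph green_summable) mulrAC.
rewrite E; under [in LHS]eq_bigr do rewrite E.
by rewrite -mulr_sumr invfM mulrACA divff // mul1r.
Qed.

End Limits.

Theorem theoremI (R : realType) (V : countType) (a : V -> V -> R)
    (d : measure_display) (T : measurableType d)
    (P : V -> probability T R) (X : nat -> T -> V) (C : R)
    (a_graph : weighted_graph a) (a_conn : connected_graph a)
    (X_walk : random_walk a P X) (X_trans : transient P X)
    (C_ge1 : 1 <= C) (a_harnack : weak_harnack a C)
    (A : set V) (A_fin : finite_set A) (y : V) (Ay : A y) :
  (forall x, 0 < hit_prob P X A x) /\
  (forall x0, \forall m \near \oo,
     A `<=` gball a x0 m%:R /\ 0 < capacity a P X (gball a x0 m%:R) A) /\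
  exists l : R,
    hitting_law P X A x y @[x --> far_from a A] --> l /\
    forall x0, escape_law a P X A x0 m y @[m --> \oo] --> l.
Proof.
move: A_fin Ay => /finite_fsetP[F AF] Ay.
have {AF} AE : A = [set` enum_fset F] by rewrite AF.
rewrite {A}AE in Ay *; have F_uniq := fset_uniq F; have yF : y \in enum_fset F := Ay.
move: (enum_fset F) F_uniq yF {Ay} => s s_uniq ys.
split; first by move=> x; exact: (hit_prob_gt0 a_graph X_walk a_conn x ys).
split.
  move=> x0; near=> m; split; last first.
    near: m; have := capacity_cvg a_graph X_walk a_conn X_trans s_uniq x0.
    move=> /cvgr_gt; apply; exact: (sum_escape_gt0 a_graph X_walk a_conn X_trans s_uniq ys).
  near: m.
  (* Connectedness puts each point of the list in all large balls; the induction makes this uniform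
     over the finite list. *)
  elim: s {s_uniq ys} => [|z s IHs]; first by near=> m; move=> z.
  near=> m => w /=; rewrite inE => /orP[/eqP->|ws]; first by near: m; exact: gball_near.
  suff : [set` s] `<=` gball a x0 m%:R by apply.
  by near: m.
exists (vweight a y * escape a s y / \sum_(z <- s) vweight a z * escape a s z); split.
  exact: (hitting_law_cvg a_graph X_walk a_conn X_trans s_uniq C_ge1 a_harnack ys).
by move=> x0; exact: (escape_law_cvg a_graph X_walk a_conn X_trans s_uniq x0 ys).
Unshelve. all: by end_near. Qed.
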